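(* For $|q|<1$ ($q\neq0$) and every $m\in\mathbb Z$, $$\mathbf J_m(q)^{-1}=\begin{pmatrix}1 & L^{(0)}_m(q) & -L^{(1)}_m(q)\\ 0 & -G^{(0)}_{m+1}(q) & G^{(1)}_{m+1}(q)\\ 0 & G^{(0)}_m(q) & -G^{(1)}_m(q)\end{pmatrix},$$ where $L^{(0)}_m=G^{(0)}_{m+1}G^{(2)}_m-G^{(0)}_mG^{(2)}_{m+1}$ and $L^{(1)}_m=G^{(1)}_{m+1}G^{(2)}_m-G^{(1)}_mG^{(2)}_{m+1}$ (all evaluated at $q$). Moreover $$L^{(0)}_m(q)=2E^{(0)}_1(q)-1-m+\sum_{n\ge1}(-1)^n\frac{q^{n(n+1)/2}}{(q;q)_n^2}\frac{q^{mn+n}}{1-q^n},$$ $$L^{(1)}_m(q)=-\tfrac38-2E^{(0)}_1(q)^2+2E^{(0)}_1(q)-E^{(0)}_2(q)-\tfrac1{24}E_2(q)+2mE^{(0)}_1(q)-m-\tfrac{m^2}2+\sum_{n\ge1}(-1)^n\frac{q^{n(n+1)/2}}{(q;q)_n^2}\frac{q^{mn+n}}{1-q^n}\Big(n+m+\tfrac12-2E^{(n)}_1(q)+\frac1{1-q^n}\Big).$$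
   Context: Notation: $(a;q)_n=\prod_{j=0}^{n-1}(1-aq^j)$. For $|q|<1$, $E_k^{(n)}(q)=\sum_{s\ge1}s^{k-1}\frac{q^{s(n+1)}}{1-q^s}$, $E_2(q)=1-24E_2^{(0)}(q)$, and $G^{(0)}_m(q)=\sum_{n\ge0}(-1)^n\frac{q^{n(n+1)/2+mn}}{(q;q)_n^2}$, $G^{(1)}_m(q)=\sum_{n\ge0}\big(n+m+\tfrac12-2E_1^{(n)}(q)\big)(-1)^n\frac{q^{n(n+1)/2+mn}}{(q;q)_n^2}$, $G^{(2)}_m(q)=\sum_{n\ge0}\Big(\tfrac12\big(n+m+\tfrac12-2E_1^{(n)}(q)\big)^2-E_2^{(n)}(q)-\tfrac1{24}E_2(q)\Big)(-1)^n\frac{q^{n(n+1)/2+mn}}{(q;q)_n^2}$. $\mathbf J_m(q)$ is the $3\times3$ matrix with rows $(1,G^{(2)}_m,G^{(2)}_{m+1})$, $(0,G^{(1)}_m,G^{(1)}_{m+1})$, $(0,G^{(0)}_m,G^{(0)}_{m+1})$. *)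

(* Defs.v *)
From Stdlib Require Import ClassicalEpsilon.
From mathcomp Require Import all_boot all_order all_algebra.
From mathcomp Require Import reals.
From mathcomp.real_closed Require Import complex.
Import Order.TTheory GRing.Theory Num.Theory.
Set Implicit Arguments.
Unset Strict Implicit.
Unset Printing Implicit Defensive.
Local Open Scope ring_scope.

Section Defs.
Variable R : realType.
Local Notation C := R[i].

Definition series_to (a : nat -> C) (l : C) : Prop :=
  forall e : R, 0 < e -> exists N : nat, forall n : nat, (N <= n)%N ->
    `| \sum_(k < n) a k - l | < e%:C%C.

(* the value of sum_{k>=0} a k (the limit of the partial sums, when it exists) *)
Definition csum (a : nat -> C) : C :=
  epsilon (inhabits 0) (fun l => series_to a l).

Definition qpoch (a q : C) (n : nat) : C := \prod_(j < n) (1 - a * q ^+ j).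

(* E_k^{(n)}(q) = sum_{s>=1} s^{k-1} q^{s(n+1)} / (1 - q^s)  (index shifted s = t+1) *)
Definition Ekn (k n : nat) (q : C) : C :=
  csum (fun t => (t.+1)%:R ^+ k.-1 * q ^+ (t.+1 * n.+1) / (1 - q ^+ t.+1)).

Definition E2 (q : C) : C := 1 - 24 * Ekn 2 0 q.

Definition gterm (m : int) (q : C) (n : nat) : C :=
  (-1) ^+ n * q ^ (((n * n.+1)./2)%:Z + m * n%:Z) / (qpoch q q n) ^+ 2.

Definition cfun (m : int) (q : C) (n : nat) : C :=
  n%:R + m%:~R + 2^-1 - 2 * Ekn 1 n q.

Definition G0 (m : int) (q : C) : C := csum (fun n => gterm m q n).
Definition G1 (m : int) (q : C) : C := csum (fun n => cfun m q n * gterm m q n).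
Definition G2 (m : int) (q : C) : C :=
  csum (fun n => (2^-1 * (cfun m q n) ^+ 2 - Ekn 2 n q - 24^-1 * E2 q)
                 * gterm m q n).

Definition Jmat (m : int) (q : C) : 'M[C]_3 :=
  \matrix_(i < 3, j < 3)
    nth 0 (nth [::] [:: [:: 1; G2 m q; G2 (m + 1) q];
                        [:: 0; G1 m q; G1 (m + 1) q];
                        [:: 0; G0 m q; G0 (m + 1) q]] i) j.

Definition L0 (m : int) (q : C) : C :=
  G0 (m + 1) q * G2 m q - G0 m q * G2 (m + 1) q.
Definition L1 (m : int) (q : C) : C :=
  G1 (m + 1) q * G2 m q - G1 m q * G2 (m + 1) q.

Definition Jinv (m : int) (q : C) : 'M[C]_3 :=
  \matrix_(i < 3, j < 3)
    nth 0 (nth [::] [:: [:: 1; L0 m q; - L1 m q];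
                        [:: 0; - G0 (m + 1) q; G1 (m + 1) q];
                        [:: 0; G0 m q; - G1 m q]] i) j.

End Defs.

(* Main.v *)
(** The summands [g_n = (-1)^n q^(n(n+1)/2+mn) / (q;q)_n^2] satisfy
    [(1 - q^n)^2 g_n(m) = - q^(m+n) g_(n-1)(m)] and [q^n g_n(m) = g_n(m+1)], so that
    [G0] and [G1] solve [X_(m+2) = (2 - q^(m+1)) X_(m+1) - X_m] and [G2] solves the same
    recurrence with the inhomogeneous term [1]. Hence the Wronskian of [G1] and [G0] does
    not depend on [m], while [L0] and [L1] have differences [- G0_(m+1)] and
    [- G1_(m+1)]; so do the right-hand sides of the claimed formulas. The resulting
    constants are identified by letting [m] tend to infinity, where only the [n = 0]
    terms survive, up to an error that decays geometrically in [m]. *)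
Require Import Defs.
From Stdlib Require Import ClassicalEpsilon FunctionalExtensionality.
From mathcomp Require Import all_boot all_order all_algebra.
From mathcomp Require Import reals.
From mathcomp.real_closed Require Import complex.
From mathcomp Require Import ring lra zify.
From mathcomp Require topology normedtype sequences.
Import Order.TTheory GRing.Theory Num.Theory.
Local Open Scope ring_scope.

Set Implicit Arguments.
Unset Strict Implicit.
Unset Printing Implicit Defensive.
Import ComplexField.Normc.

(** * Powers of a ratio below one, and geometrically dominated real series *)

(** This bounds from below the [n+1] terms of [s^(n+1) - r^(n+1) = (s - r) * sum s^i r^(n-i)]. With
    [s = 1] it makes [r^n] small; with [r < s < 1] it absorbs a factor [n] into a slightly larger
    ratio. *)
Lemma expr_bernoulli (R : realType) (r s : R) n : 0 <= r -> r <= s ->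
  n.+1%:R * (s - r) * r ^+ n <= s ^+ n.+1.
Proof.
move=> r0 rs; elim: n => [|n IH]; first by rewrite expr0 expr1; lra.
have Hrs : r ^+ n.+1 <= s ^+ n.+1 by apply: lerXn2r; rewrite ?nnegrE //; lra.
rewrite [s ^+ n.+2]exprS -[n.+2%:R]natr1 [r ^+ n.+1]exprS.
move: Hrs IH; rewrite [r ^+ n.+1]exprS; set x := r ^+ n; set y := s ^+ n.+1 => Hrs IH.
have := ler_wpM2l r0 IH.
have : (s - r) * (r * x) <= (s - r) * y by apply: ler_wpM2l; lra.
lra.
Qed.

Lemma expr_small (R : realType) (K r e : R) : 0 <= r -> r < 1 -> 0 < e ->
  exists N, forall n, (N <= n)%N -> K * r ^+ n < e.
Proof.
(* Bernoulli with [s = 1] gives [(n+1)(1-r) r^n <= 1], so any [n+1 > M] suffices. *)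
move=> r0 r1 e0; pose M := `|K| / ((1 - r) * e).
have d0 : 0 < (1 - r) * e by apply: mulr_gt0; lra.
exists (Num.bound M) => n Nn.
have MN : M < n.+1%:R.
  apply: lt_le_trans (_ : (Num.bound M)%:R <= _); last by rewrite ler_nat; lia.
  by rewrite archi_boundP // /M divr_ge0 // ltW.
have /= := @expr_bernoulli R r 1 n r0 (ltW r1); rewrite expr1n.
move: MN; rewrite /M ltr_pdivrMr //.
have := exprn_ge0 n r0; set x := r ^+ n; set k := n.+1%:R => x0 Kk kx.
have KK : K <= `|K| by apply: ler_norm.
have h1 : K * x <= `|K| * x by apply: ler_wpM2r.
apply: le_lt_trans h1 _; rewrite le_eqVlt in x0; case/orP: x0 => [/eqP<-|x0].
  by rewrite mulr0.
have h2 : `|K| * x < k * ((1 - r) * e) * x by rewrite ltr_pM2r.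
have h3 := ler_wpM2l (ltW e0) kx.
lra.
Qed.

Section RealSeries.
Import topology normedtype sequences numFieldNormedType.Exports.

Lemma real_series_cvg (R : realType) (u : nat -> R) (K r : R) : 0 <= r -> r < 1 ->
  (forall n, `|u n| <= K * r ^+ n) ->
  exists l : R, forall e, 0 < e -> exists N, forall n, (N <= n)%N ->
    `|\sum_(k < n) u k - l| < e.
Proof.
move=> r0 r1 ub.
have cu : cvgn (series u).
  apply: normed_cvg.
  apply: (@series_le_cvg R _ (geometric K r)) => [n|n|n|].
  - exact: normr_ge0.
  - exact: le_trans (normr_ge0 _) (ub n).
  - exact: ub.
  - by apply: is_cvg_geometric_series; rewrite ger0_norm.
exists (limn (series u)) => e e0.
have /cvgrPdist_lt /(_ _ e0) [N _ HN] := cu.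
by exists N => n Nn; have := HN n Nn; rewrite /series /= big_mkord distrC.
Qed.

End RealSeries.

(** * Complex series with geometrically bounded terms, and multipliers preserving them *)

Section Series.
Variable R : realType.
Local Notation C := R[i].
Implicit Types (a b u v w : nat -> C) (x l : C).

Lemma normrE_normc x : `|x| = (normc x)%:C%C. Proof. by []. Qed.

Lemma normc_ge0 x : 0 <= normc x.
Proof. by rewrite -lecR -normrE_normc normr_ge0. Qed.

Lemma normcX x n : normc (x ^+ n) = normc x ^+ n.
Proof. by elim: n => [|n IH]; rewrite ?expr0 ?normc1 // !exprS normcM IH. Qed.

Lemma normc_nat n : normc (n%:R : C) = n%:R.
Proof. by rewrite normcMn normc1. Qed.

Lemma ge_normcB x y : normc x - normc y <= normc (x - y).
Proof. by have := le_normcD (x - y) y; rewrite subrK lerBlDr. Qed.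

Lemma normc_sum a n : normc (\sum_(k < n) a k) <= \sum_(k < n) normc (a k).
Proof.
elim: n => [|n IH]; rewrite ?big_ord0 ?normc0 // !big_ord_recr /=.
by apply: le_trans (le_normcD _ _) _; apply: lerD.
Qed.

(** Plays two roles: summability in the index [n] of a series, and decay to zero in the parameter
    [m]. *)
Definition geo a := exists K r : R,
  [/\ 0 <= r, r < 1 & forall n, normc (a n) <= K * r ^+ n].

Lemma geo_sum_le (K r : R) n : 0 <= K -> 0 <= r -> r < 1 ->
  \sum_(k < n) K * r ^+ k <= K / (1 - r).
Proof.
move=> K0 r0 r1; rewrite -mulr_sumr; apply: ler_wpM2l => //.
have d0 : 0 < 1 - r by lra.
have e : (1 - r) * (\sum_(k < n) r ^+ k) = 1 - r ^+ n.
  by rewrite -opprB mulNr -subrX1 opprB.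
rewrite -[leRHS]mul1r ler_pdivlMr // mulrC e.
by have := exprn_ge0 n r0; lra.
Qed.

Lemma normc_le_ReIm x : normc x <= `|complex.Re x| + `|complex.Im x|.
Proof.
case: x => a b /=; rewrite -[leRHS]ger0_norm ?addr_ge0 // -sqrtr_sqr.
apply: ler_wsqrtr; rewrite sqrrD !real_normK ?num_real //.
by have := mulr_ge0 (normr_ge0 a) (normr_ge0 b); lra.
Qed.

Lemma Re_le_normc x : `|complex.Re x| <= normc x.
Proof.
case: x => a b /=; rewrite -sqrtr_sqr; apply: ler_wsqrtr.
by have := sqr_ge0 b; lra.
Qed.

Lemma Im_le_normc x : `|complex.Im x| <= normc x.
Proof.
case: x => a b /=; rewrite -sqrtr_sqr; apply: ler_wsqrtr.
by have := sqr_ge0 a; lra.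
Qed.

Lemma series_to_normc a l : series_to a l <->
  forall e : R, 0 < e -> exists N, forall n, (N <= n)%N ->
    normc (\sum_(k < n) a k - l) < e.
Proof.
by split=> h e /h [N HN]; exists N => n /HN; rewrite normrE_normc ltcR.
Qed.

Lemma series_to_uniq a l l' : series_to a l -> series_to a l' -> l = l'.
Proof.
move=> /series_to_normc h /series_to_normc h'; apply/eqP; rewrite -subr_eq0.
apply/eqP/eq0_normc/eqP; rewrite eq_le normc_ge0 andbT leNgt; apply/negP => d0.
have d2 : 0 < normc (l - l') / 2 by lra.
have [N HN] := h _ d2; have [N' HN'] := h' _ d2.
have := HN (maxn N N') (leq_maxl _ _); have := HN' (maxn N N') (leq_maxr _ _).
set s := \sum_(_ < _) _ => k1 k2.
have := le_normcD (s - l') (- (s - l)); rewrite normcN.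
have -> : s - l' + - (s - l) = l - l' by ring.
lra.
Qed.

(** Limits are unique, so the choice made by [epsilon] is forced as soon as one limit exists. *)
Lemma csumP a l : series_to a l -> csum a = l.
Proof.
move=> h; apply: (@series_to_uniq a) => //.
by apply: (@epsilon_spec _ (inhabits 0) (series_to a)); exists l.
Qed.

Lemma geo_cvg a : geo a -> series_to a (csum a).
Proof.
case=> K [r [r0 r1 h]].
suff [l hl] : exists l, series_to a l by rewrite (csumP hl).
have [n|x hx] := @real_series_cvg R (fun n => complex.Re (a n)) K r r0 r1.
  exact: le_trans (Re_le_normc _) (h n).
have [n|y hy] := @real_series_cvg R (fun n => complex.Im (a n)) K r r0 r1.
  exact: le_trans (Im_le_normc _) (h n).
exists (x +i* y)%C; apply/series_to_normc => e e0.
have e2 : 0 < e / 2 by lra.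
have [N HN] := hx _ e2; have [N' HN'] := hy _ e2.
exists (maxn N N') => n; rewrite geq_max => /andP[/HN k1 /HN' k2].
apply: le_lt_trans (normc_le_ReIm _) _.
by rewrite !raddfB !raddf_sum /=; lra.
Qed.

Lemma csum_le a (K r : R) : 0 <= r -> r < 1 ->
  (forall n, normc (a n) <= K * r ^+ n) -> normc (csum a) <= K / (1 - r).
Proof.
move=> r0 r1 h; have /geo_cvg/series_to_normc hl : geo a by exists K, r.
have K0 : 0 <= K by have := h 0%N; rewrite expr0 mulr1; apply: le_trans (normc_ge0 _).
(* Otherwise a partial sum close enough to the limit would exceed the bound valid for all partial
   sums. *)
rewrite leNgt; apply/negP => lt.
have [|N /(_ N (leqnn _))] := hl (normc (csum a) - K / (1 - r)); first by lra.
have le1 := le_trans (normc_sum a N) (ler_sum _ (fun (i : 'I_N) _ => h i)).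
have k2 := le_trans le1 (geo_sum_le N K0 r0 r1).
have := ge_normcB (csum a) (\sum_(k < N) a k); rewrite -[normc (_ - _)]normcN opprB.
lra.
Qed.

Lemma eq_geo a b : a =1 b -> geo a -> geo b.
Proof. by move=> /functional_extensionality ->. Qed.

Lemma eq_csum a b : a =1 b -> csum a = csum b.
Proof. by move=> /functional_extensionality ->. Qed.

Lemma geoD a b : geo a -> geo b -> geo (fun n => a n + b n).
Proof.
move=> [K [r [r0 r1 h]]] [K' [r' [r0' r1' h']]].
exists (`|K| + `|K'|), (Num.max r r').
split=> [||n]; first by rewrite le_max r0.
  by rewrite gt_max r1.
apply: le_trans (le_normcD _ _) _; rewrite mulrDl; apply: lerD.
  apply: le_trans (h n) _; apply: le_trans (ler_wpM2r (exprn_ge0 n r0) (ler_norm K)) _.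
  by apply: ler_wpM2l => //; apply: lerXn2r; rewrite ?nnegrE ?le_max ?lexx ?r0.
apply: le_trans (h' n) _; apply: le_trans (ler_wpM2r (exprn_ge0 n r0') (ler_norm K')) _.
by apply: ler_wpM2l => //; apply: lerXn2r; rewrite ?nnegrE ?le_max ?lexx ?r0' ?orbT.
Qed.

(* Every polynomial in [n] with bounded coefficients is tame. *)
Definition tame w := forall a, geo a -> geo (fun n => w n * a n).

Lemma eq_tame u v : u =1 v -> tame u -> tame v.
Proof. by move=> /functional_extensionality ->. Qed.

Lemma tame_bounded w (B : R) : (forall n, normc (w n) <= B) -> tame w.
Proof.
move=> hw a [K [r [r0 r1 h]]]; exists (B * K), r; split=> // n.
rewrite normcM -mulrA; apply: ler_pM => //; exact: normc_ge0.
Qed.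

Lemma tame_cst x : tame (fun _ => x).
Proof. exact: (@tame_bounded _ (normc x)). Qed.

Lemma tameD u v : tame u -> tame v -> tame (fun n => u n + v n).
Proof.
move=> hu hv a ga; apply: eq_geo (geoD (hu _ ga) (hv _ ga)) => n.
by rewrite mulrDl.
Qed.

Lemma tameM u v : tame u -> tame v -> tame (fun n => u n * v n).
Proof. by move=> hu hv a /hv/hu; apply: eq_geo => n; rewrite mulrA. Qed.

Lemma tameN u : tame u -> tame (fun n => - u n).
Proof.
by move/(tameM (tame_cst (-1))) => h a /h; apply: eq_geo => n; rewrite mulN1r.
Qed.

Lemma tame_nat : tame (fun n => n%:R).
Proof.
(* The midpoint of [r] and [1]: the gap [s - r] pays for the factor [n]. *)
move=> a [K [r [r0 r1 h]]]; pose s := (1 + r) / 2.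
have rs : r < s by rewrite /s; lra.
have s1 : s < 1 by rewrite /s; lra.
exists (`|K| / (s - r)), s; split=> //; first by lra.
move=> n; rewrite normcM normc_nat mulrAC ler_pdivlMr ?subr_gt0 //.
have h1 : n%:R * (s - r) * r ^+ n <= s ^+ n.
  apply: le_trans (_ : n.+1%:R * (s - r) * r ^+ n <= _).
    apply: ler_wpM2r; first exact: exprn_ge0.
    by apply: ler_wpM2r; [lra|rewrite ler_nat].
  apply: le_trans (expr_bernoulli n r0 (ltW rs)) _.
  by rewrite exprS ler_piMl ?exprn_ge0; lra.
have h2 : normc (a n) <= `|K| * r ^+ n.
  by apply: le_trans (h n) _; apply: ler_wpM2r; [exact: exprn_ge0|exact: ler_norm].
have h3 := ler_wpM2l (normr_ge0 K) h1.
have h4 : n%:R * (s - r) * normc (a n) <= n%:R * (s - r) * (`|K| * r ^+ n).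
  by apply: ler_wpM2l => //; apply: mulr_ge0 => //; lra.
lra.
Qed.

Lemma geo_tame a : geo a -> tame a.
Proof.
move=> [K [r [r0 r1 h]]]; apply: (@tame_bounded _ `|K|) => n.
apply: le_trans (h n) _; apply: le_trans (ler_wpM2r (exprn_ge0 n r0) (ler_norm K)) _.
by rewrite ler_piMr // exprn_ile1 // ltW.
Qed.

Lemma geoN a : geo a -> geo (fun n => - a n).
Proof. by move/(tame_cst (-1)); apply: eq_geo => n; rewrite mulN1r. Qed.

Lemma geoS a : geo a -> geo (fun n => a n.+1).
Proof.
by move=> [K [r [r0 r1 h]]]; exists (K * r), r; split=> // n; rewrite -mulrA -exprS.
Qed.

(** Turns decay into an exact identity once a quantity is known to be independent of [m]. *)
Lemma geo_const x : geo (fun _ => x) -> x = 0.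
Proof.
move=> [K [r [r0 r1 h]]]; apply/eq0_normc/eqP; rewrite eq_le normc_ge0 andbT leNgt.
apply/negP => /(expr_small K r0 r1) [N /(_ N (leqnn _))].
by rewrite ltNge h.
Qed.

Lemma geo_ratio a (B r : R) : 0 <= r -> r < 1 ->
  (forall n, normc (a n.+1) <= B * r ^+ n * normc (a n)) -> geo a.
Proof.
move=> r0 r1 h; have [|N HN] := @expr_small R B r 2^-1 r0 r1; first by lra.
(* From [N] on, each step at least halves the norm; the constant dominates [normc (a i) * 2^i] for
   every earlier [i]. *)
exists (\sum_(i < N.+1) normc (a i) * 2 ^+ i), 2^-1; split; [lra|lra|].
have hpow n : 2 ^+ n * 2^-1 ^+ n = 1 :> R.
  by rewrite -exprMn divff ?expr1n //; lra.
elim=> [|n IH].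
  rewrite big_ord_recl !expr0 !mulr1 lerDl; apply: sumr_ge0 => i _.
  by rewrite mulr_ge0 ?normc_ge0 ?exprn_ge0.
case: (leqP N n) => Nn.
  apply: le_trans (h n) _; rewrite exprS mulrCA.
  apply: le_trans (ler_wpM2r (normc_ge0 _) (ltW (HN _ Nn))) _.
  by apply: ler_wpM2l => //; lra.
rewrite (bigD1 (Ordinal (Nn : (n.+1 < N.+1)%N))) //= mulrDl -mulrA hpow mulr1 lerDl.
apply: mulr_ge0; last by apply: exprn_ge0; lra.
by apply: sumr_ge0 => i _; rewrite mulr_ge0 ?normc_ge0 ?exprn_ge0.
Qed.

Lemma csumD a b : geo a -> geo b -> csum (fun n => a n + b n) = csum a + csum b.
Proof.
move=> /geo_cvg/series_to_normc ha /geo_cvg/series_to_normc hb.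
apply: csumP; apply/series_to_normc => e e0.
have e2 : 0 < e / 2 by lra.
have [N HN] := ha _ e2; have [N' HN'] := hb _ e2.
exists (maxn N N') => n; rewrite geq_max => /andP[/HN k1 /HN' k2].
rewrite big_split opprD addrACA.
by apply: le_lt_trans (le_normcD _ _) _; lra.
Qed.

Lemma csumZ x a : geo a -> csum (fun n => x * a n) = x * csum a.
Proof.
move=> /geo_cvg/series_to_normc ha; apply: csumP; apply/series_to_normc => e e0.
have d0 : 0 < normc x + 1 by have := normc_ge0 x; lra.
have [|N HN] := ha (e / (normc x + 1)); first exact: divr_gt0.
exists N => n /HN; rewrite -mulr_sumr -mulrBr normcM ltr_pdivlMr //.
set z := normc (_ - _) => k; have : 0 <= z by exact: normc_ge0.
lra.
Qed.

Lemma csum_recl a : geo a -> csum a = a 0%N + csum (fun n => a n.+1).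
Proof.
move=> ga; apply: csumP; apply/series_to_normc => e e0.
have /geo_cvg/series_to_normc /(_ e e0) [N HN] := geoS ga.
exists N.+1 => -[//|n] /HN; rewrite big_ord_recl opprD addrACA subrr add0r.
by apply: le_lt_trans.
Qed.

(** The exponent [m(k+1)] is at least [m], so every term carries a factor bounded by [normc q ^ m].
    All decay in [m] comes from here. *)
Lemma geo_csum_tail a (q : C) : normc q < 1 -> geo a ->
  geo (fun m => csum (fun k => a k * q ^+ (m * k.+1))).
Proof.
move=> q1 [K [r [r0 r1 h]]]; exists (K / (1 - r)), (normc q); split=> //.
  exact: normc_ge0.
move=> m; rewrite mulrAC; apply: csum_le => // n.
rewrite normcM normcX mulrAC; apply: ler_pM => //.
- exact: normc_ge0.
- by rewrite exprn_ge0 ?normc_ge0.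
rewrite ler_wiXn2l //; [exact: normc_ge0|exact: ltW|lia].
Qed.

End Series.

(** * Geometric series and the denominators [1 - q^(n+1)] *)

Section QSeries.
Variables (R : realType) (q : R[i]).
Local Notation C := R[i].
Hypotheses (q0 : q != 0) (q1 : normc q < 1).
Implicit Types (w : nat -> C) (x : C) (m : int).

Lemma subr1_neq0 x : normc x < 1 -> 1 - x != 0.
Proof.
by move=> h; rewrite subr_eq0 eq_sym; apply: contraTneq h => ->; rewrite normc1 ltxx.
Qed.

Lemma geo_expr x : normc x < 1 -> geo (fun n => x ^+ n).
Proof.
move=> h; exists 1, (normc x); split=> [||n] //; first exact: normc_ge0.
by rewrite mul1r normcX.
Qed.

Lemma csum_geometric x : normc x < 1 -> csum (fun n => x ^+ n) = (1 - x)^-1.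
Proof.
move=> h; have g := geo_expr h; have d0 := subr1_neq0 h.
apply: (mulfI d0); rewrite divff // mulrBl mul1r {1}(csum_recl g) expr0.
by under eq_csum do rewrite exprS; rewrite csumZ // addrK.
Qed.

Lemma tame_natS : tame (fun n => n.+1%:R : C).
Proof.
have := tameD (@tame_nat R) (tame_cst 1).
by congr tame; apply: functional_extensionality => n; rewrite natr1.
Qed.

Lemma csum_arith_geometric x : normc x < 1 ->
  csum (fun n => n.+1%:R * x ^+ n) = (1 - x)^-1 ^+ 2.
Proof.
move=> h; have g := geo_expr h; have d0 := subr1_neq0 h.
have g1 := tame_natS g.
apply: (mulfI d0); rewrite expr2 mulVKf // mulrBl mul1r {1}(csum_recl g1) expr0 mulr1.
(* Splitting [n+2] as [(n+1) + 1] leaves [x] times the original series plus a geometric one. *)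
rewrite (@eq_csum _ _ (fun n => x * (n.+1%:R * x ^+ n) + x ^+ n.+1)); last first.
  by move=> n; rewrite -[n.+2%:R]natr1 exprS; ring.
rewrite csumD ?csumZ //; last by apply: geoS.
  by rewrite -(csum_geometric h) (csum_recl g) expr0; ring.
exact: (tame_cst x).
Qed.

Lemma normc_qX n : normc (q ^+ n.+1) <= normc q.
Proof. by rewrite normcX exprS ler_piMr ?normc_ge0 // exprn_ile1 ?normc_ge0 // ltW. Qed.

Lemma normc_qX_lt1 n : normc (q ^+ n.+1) < 1.
Proof. exact: le_lt_trans (normc_qX n) q1. Qed.

Lemma subr1_qX_neq0 n : 1 - q ^+ n.+1 != 0.
Proof. exact: subr1_neq0 (normc_qX_lt1 n). Qed.

Lemma normc_subr1_qXV n : normc (1 - q ^+ n.+1)^-1 <= (1 - normc q)^-1.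
Proof.
have d0 : 0 < 1 - normc q by rewrite subr_gt0.
have h : 1 - normc q <= normc (1 - q ^+ n.+1).
  apply: le_trans (ge_normcB _ _); rewrite normc1.
  by have := normc_qX n; lra.
by rewrite normcV lef_pV2 ?posrE //; lra.
Qed.

Lemma tame_subr1_qXV : tame (fun n => (1 - q ^+ n.+1)^-1).
Proof. exact: tame_bounded normc_subr1_qXV. Qed.

(** * The Lambert series [Ekn] and their recurrence in [n] *)

Definition Eterm k n t : C := (t.+1)%:R ^+ k.-1 * q ^+ (t.+1 * n.+1) / (1 - q ^+ t.+1).

(** The bound is uniform in [n], since [q^((t+1)(n+1))] has norm at most that of [q^(t+1)]; hence
    [Ekn k n q] is bounded in [n]. *)
Lemma Eterm_le k : exists K r : R, [/\ 0 <= r, r < 1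
  & forall n t, normc (Eterm k n t) <= K * r ^+ t].
Proof.
have tX j : tame (fun t => t.+1%:R ^+ j : C).
  elim: j => [|j IH]; first exact: (tame_cst 1).
  have := tameM tame_natS IH.
  by congr tame; apply: functional_extensionality => n; rewrite exprS.
have [K [r [r0 r1 h]]] := tX k.-1 _ (geoS (geo_expr q1)).
exists (K / (1 - normc q)), r; split=> // n t.
rewrite mulrAC /Eterm normcM; apply: ler_pM; rewrite ?normc_ge0 ?normc_subr1_qXV //.
apply: le_trans (h t); rewrite !normcM; apply: ler_wpM2l; first exact: normc_ge0.
rewrite !normcX ler_wiXn2l ?normc_ge0 ?(ltW q1) //; lia.
Qed.

Lemma geo_Eterm k n : geo (Eterm k n).
Proof. by have [K [r [r0 r1 h]]] := Eterm_le k; exists K, r; split. Qed.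

Lemma tame_Ekn k : tame (fun n => Ekn k n q).
Proof.
have [K [r [r0 r1 h]]] := Eterm_le k; apply: (@tame_bounded _ _ (K / (1 - r))) => n.
exact: csum_le r0 r1 (h n).
Qed.

(** Subtracting consecutive Lambert terms produces the factor [1 - q^(t+1)], which cancels the
    denominator. *)
Lemma Ekn_recl k n : Ekn k n q = Ekn k n.+1 q
  + csum (fun t => t.+1%:R ^+ k.-1 * (q ^+ n.+1) ^+ t.+1).
Proof.
have e t : t.+1%:R ^+ k.-1 * (q ^+ n.+1) ^+ t.+1 = Eterm k n t - Eterm k n.+1 t.
  have d0 := subr1_qX_neq0 t; apply: (mulIf d0).
  rewrite /Eterm -exprM -mulrBl -mulrBr divfK // -mulrA [_ * (1 - _)]mulrBr mulr1 -exprD.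
  by congr (_ * (_ ^+ _ - _ ^+ _)); lia.
rewrite (eq_csum e) -/(Eterm k n) csumD; last exact: geoN (geo_Eterm k n.+1).
  have -> : csum (fun t => - Eterm k n.+1 t) = - Ekn k n.+1 q.
    by rewrite -mulN1r -csumZ; [apply: eq_csum => t; rewrite mulN1r|exact: geo_Eterm].
  by rewrite addrC subrK.
exact: geo_Eterm.
Qed.

Lemma E1_recl n : Ekn 1 n q = Ekn 1 n.+1 q + q ^+ n.+1 / (1 - q ^+ n.+1).
Proof.
rewrite Ekn_recl /=; congr (_ + _); set x := q ^+ n.+1.
rewrite -(csum_geometric (normc_qX_lt1 n)) -csumZ; last exact: geo_expr (normc_qX_lt1 n).
by apply: eq_csum => t; rewrite mul1r exprS.
Qed.

Lemma E2_recl n : Ekn 2 n q = Ekn 2 n.+1 q + q ^+ n.+1 * (1 - q ^+ n.+1)^-1 ^+ 2.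
Proof.
rewrite Ekn_recl /=; congr (_ + _); set x := q ^+ n.+1.
rewrite -(csum_arith_geometric (normc_qX_lt1 n)) -csumZ.
  by apply: eq_csum => t; rewrite expr1 exprS mulrCA.
exact: tame_natS (geo_expr (normc_qX_lt1 n)).
Qed.

(** * The summands [gterm]: shifts in [m] and [n], and decay *)

Lemma gterm0 m : gterm m q 0 = 1.
Proof. by rewrite /gterm /qpoch big_ord0 mulr0 expr0 expr1n invr1 !mulr1. Qed.

Lemma gtermE m n : gterm m q n = gterm 0 q n * q ^ (m * n%:Z).
Proof. by rewrite /gterm mul0r addr0 expfzDr //; ring. Qed.

Lemma gtermD m i n : gterm (m + i) q n = gterm m q n * q ^ (i * n%:Z).
Proof. by rewrite gtermE [gterm m _ _]gtermE mulrDl expfzDr // mulrA. Qed.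

Lemma gterm_natE (m n : nat) : gterm m%:Z q n = gterm 0 q n * q ^+ (m * n).
Proof. by rewrite gtermE -PoszM. Qed.

Lemma gterm_shift m n : gterm (m + 1) q n = q ^+ n * gterm m q n.
Proof.
by rewrite gtermE [gterm m q n]gtermE mulrDl mul1r expfzDr // -exprnP; ring.
Qed.

Lemma gtermS m n : (1 - q ^+ n.+1) ^+ 2 * gterm m q n.+1
  = - q ^ (m + 1) * (q ^+ n * gterm m q n).
Proof.
have d0 := subr1_qX_neq0 n.
rewrite /gterm /qpoch big_ord_recr /= -exprS.
have -> : ((n.+1 * n.+2)./2)%:Z + m * n.+1%:Z
        = ((n * n.+1)./2)%:Z + m * n%:Z + (m + 1) + n%:Z.
  have -> : ((n.+1 * n.+2)./2 = (n * n.+1)./2 + n.+1)%N.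
    have -> : (n.+1 * n.+2 = n * n.+1 + n.+1.*2)%N by lia.
    by rewrite halfD odd_double andbF add0n doubleK.
  by lia.
rewrite !(expfzDr _ _ q0) -!exprnP exprMn invfM [(-1) ^+ n.+1]exprS.
set P := (\prod_(_ < n) _) ^+ 2.
move: (expf_neq0 2 d0); set D := (1 - _) ^+ 2; move: (q ^ m) (q ^ (m * n)) => y z D0.
by rewrite mulrC [_ * (P^-1 / D)]mulrA divfK //; ring.
Qed.

(** By [gtermS], the ratio of consecutive terms is itself of order [q^n]; this beats the fixed
    factor [q^(m+1)], which may be large for negative [m]. *)
Lemma geo_gterm m : geo (gterm m q).
Proof.
pose B := normc (q ^ (m + 1)) * (1 - normc q)^-1 ^+ 2.
apply: (@geo_ratio _ _ B (normc q)) => // [|n]; first exact: normc_ge0.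
have d0 := subr1_qX_neq0 n.
have -> : gterm m q n.+1
  = - q ^ (m + 1) * (1 - q ^+ n.+1)^-1 ^+ 2 * q ^+ n * gterm m q n.
  apply: (mulfI (expf_neq0 2 d0)); rewrite gtermS.
  by rewrite exprVn; field.
rewrite normcM; apply: ler_wpM2r; first exact: normc_ge0.
rewrite normcM [normc (q ^+ n)]normcX; apply: ler_wpM2r.
  by rewrite exprn_ge0 // normc_ge0.
rewrite normcM normcN [normc (_ ^+ 2)]normcX /B; apply: ler_wpM2l; first exact: normc_ge0.
by apply: lerXn2r; rewrite ?nnegrE ?normc_ge0 ?invr_ge0 ?subr_ge0 ?(ltW q1) ?normc_subr1_qXV.
Qed.

(** * Three-term recurrences for [G0], [G1] and [G2] *)

(** In [F m - 2 F (m+1) + F (m+2)] the [n = 0] terms give [d]. In the term of index [n+1], each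
    shift of [m] multiplies [gterm] by [x], so the hypothesis on [w] yields
    [(1-x)^2 w_(m+1)(n) g_(n+1)(m)]; [gtermS] turns this into [-q^(m+1)] times the term [n] of
    [F (m+1)]. *)
Lemma csum_gterm_rec (w : int -> nat -> C) (d : C) m : (forall i, tame (w i)) ->
  w m 0%N - 2 * w (m + 1) 0%N + w (m + 1 + 1) 0%N = d ->
  (forall n (x := q ^+ n.+1), w m n.+1 - 2 * x * w (m + 1) n.+1
     + x ^+ 2 * w (m + 1 + 1) n.+1 = (1 - x) ^+ 2 * w (m + 1) n) ->
  let F i := csum (fun n => w i n * gterm i q n) in
  F (m + 1 + 1) = (2 - q ^ (m + 1)) * F (m + 1) - F m + d.
Proof.
move=> tw h0 hS F; have g i : geo (fun n => w i n * gterm i q n).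
  exact: tw (geo_gterm i).
have gZ (x : C) i : geo (fun n => x * (w i n * gterm i q n)) by exact: (tame_cst x (g i)).
have : F m + (- 2 * F (m + 1) + F (m + 1 + 1)) = d + - q ^ (m + 1) * F (m + 1).
  rewrite /F -!csumZ // -csumD // -csumD //; last exact: geoD.
  rewrite csum_recl; last by do !apply: geoD.
  rewrite !gterm0 !mulr1 -h0; congr (_ + _); first by ring.
  apply: eq_csum => n; rewrite !gterm_shift.
  transitivity (w (m + 1) n * ((1 - q ^+ n.+1) ^+ 2 * gterm m q n.+1)).
    by rewrite [RHS]mulrCA [RHS]mulrA -hS; ring.
  by rewrite gtermS; ring.
by move=> /(canRL (addKr _)) /(canRL (addKr _)) ->; ring.
Qed.

Definition hfun m n : C := 2^-1 * (cfun m q n) ^+ 2 - Ekn 2 n q - 24^-1 * E2 q.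

Lemma cfunS m n : cfun (m + 1) q n = cfun m q n + 1.
Proof. by rewrite /cfun intrD; ring. Qed.

(** Passing from [(m+1, n)] to [(m, n+1)] keeps [n + m] fixed, so only [Ekn 1] changes. *)
Lemma cfun_recl m n :
  cfun (m + 1) q n = cfun m q n.+1 - 2 * (q ^+ n.+1 / (1 - q ^+ n.+1)).
Proof. by rewrite /cfun E1_recl intrD -[n.+1%:R]natr1; ring. Qed.

Lemma tame_cfun m : tame (cfun m q).
Proof.
apply: tameD; first by do !apply: tameD; [exact: tame_nat|exact: tame_cst..].
by apply: tameN; apply: tameM; [exact: tame_cst|exact: tame_Ekn].
Qed.

Lemma tame_hfun m : tame (hfun m).
Proof.
apply: tameD; last exact: tame_cst.
apply: tameD; last by apply: tameN; exact: tame_Ekn.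
by do !apply: tameM; [exact: tame_cst|exact: tame_cfun..].
Qed.

Lemma G0_rec m : G0 (m + 1 + 1) q = (2 - q ^ (m + 1)) * G0 (m + 1) q - G0 m q.
Proof.
have e i : G0 i q = csum (fun n => 1 * gterm i q n).
  by apply: eq_csum => n; rewrite mul1r.
rewrite !e (@csum_gterm_rec (fun _ _ => 1) 0) ?addr0 // => [i||n x].
- exact: tame_cst.
- by ring.
- by ring.
Qed.

Lemma G1_rec m : G1 (m + 1 + 1) q = (2 - q ^ (m + 1)) * G1 (m + 1) q - G1 m q.
Proof.
rewrite /G1 (@csum_gterm_rec (fun i => cfun i q) 0) ?addr0 // => [i||n x].
- exact: tame_cfun.
- by rewrite !cfunS; ring.
have d0 := subr1_qX_neq0 n; rewrite (cfun_recl m n) !cfunS -/x.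
by field.
Qed.

(** The inhomogeneity [1] is the second difference in [m] of half the square of [cfun] at
    [n = 0]. *)
Lemma G2_rec m : G2 (m + 1 + 1) q = (2 - q ^ (m + 1)) * G2 (m + 1) q - G2 m q + 1.
Proof.
rewrite /G2 (@csum_gterm_rec hfun 1) // => [i||n x].
- exact: tame_hfun.
- by rewrite /hfun !cfunS; field.
have d0 := subr1_qX_neq0 n.
rewrite /hfun (E2_recl n) (cfun_recl m n) !cfunS -/x exprVn.
by field.
Qed.

(** * The series [U0] and [U1] in the closed forms of [L0] and [L1] *)

Definition U0 m : C := csum (fun k => gterm 0 q k.+1
  * q ^ (m * (k.+1)%:Z + (k.+1)%:Z) / (1 - q ^+ k.+1)).

Definition U1 m : C := csum (fun k => gterm 0 q k.+1
  * q ^ (m * (k.+1)%:Z + (k.+1)%:Z) / (1 - q ^+ k.+1)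
  * ((k.+1)%:R + m%:~R + 2^-1 - 2 * Ekn 1 k.+1 q + (1 - q ^+ k.+1)^-1)).

Definition uwt m (k : nat) : C := cfun m q k.+1 + (1 - q ^+ k.+1)^-1.

Lemma U0E m : U0 m = csum (fun k => (1 - q ^+ k.+1)^-1 * gterm (m + 1) q k.+1).
Proof.
by apply: eq_csum => k; rewrite [gterm (m + 1) _ _]gtermE mulrDl mul1r mulrC.
Qed.

Lemma U1E m :
  U1 m = csum (fun k => uwt m k * ((1 - q ^+ k.+1)^-1 * gterm (m + 1) q k.+1)).
Proof.
apply: eq_csum => k; rewrite [gterm (m + 1) _ _]gtermE [(m + 1) * _]mulrDl mul1r.
by rewrite [LHS]mulrC; congr (_ * _); rewrite mulrC.
Qed.

Lemma tame_uwt m : tame (uwt m).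
Proof.
apply: tameD; last exact: tame_subr1_qXV.
(* The recurrence expresses [cfun] at [k+1] through its value at [k], whose tameness is known. *)
have t : tame (fun k => cfun (m + 1) q k + 2 * (q ^+ k.+1 / (1 - q ^+ k.+1))).
  apply: tameD; first exact: tame_cfun.
  apply: tameM; first exact: tame_cst.
  by apply: tameM; [exact: geo_tame (geoS (geo_expr q1))|exact: tame_subr1_qXV].
by apply: eq_tame t => k; rewrite cfun_recl subrK.
Qed.

Lemma geo_gtermS m : geo (fun k => gterm m q k.+1).
Proof. exact: geoS (geo_gterm m). Qed.

(** Shifting [m] multiplies each term by [q^(k+1)]; the difference cancels the denominator and
    leaves minus the tail of [G0 (m+1)]. *)
Lemma U0S m : U0 (m + 1) = U0 m - (G0 (m + 1) q - 1).
Proof.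
have -> : G0 (m + 1) q - 1 = csum (fun k => gterm (m + 1) q k.+1).
  by rewrite /G0 csum_recl ?gterm0; [ring|exact: geo_gterm].
rewrite !U0E -[- _]mulN1r -csumZ; last exact: geo_gtermS.
rewrite -csumD.
- apply: eq_csum => k; rewrite [in LHS]gterm_shift.
  by have d0 := subr1_qX_neq0 k; field.
- exact: (tame_subr1_qXV (geo_gtermS _)).
- exact: (tame_cst (-1) (geo_gtermS _)).
Qed.

(** With [y = 1/(1-x)] and [c = cfun m], one has [(c+1+y)xy - (c+y)y = -(c+1)]: the extra summand
    [y] of the weight accounts for the increment of [cfun]. *)
Lemma U1S m : U1 (m + 1) = U1 m - (G1 (m + 1) q - cfun (m + 1) q 0).
Proof.
have g : geo (fun n => cfun (m + 1) q n * gterm (m + 1) q n).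
  exact: (tame_cfun _ (geo_gterm _)).
have -> : G1 (m + 1) q - cfun (m + 1) q 0
    = csum (fun k => cfun (m + 1) q k.+1 * gterm (m + 1) q k.+1).
  by rewrite /G1 csum_recl // gterm0; ring.
rewrite !U1E -[- _]mulN1r -csumZ; last exact: (geoS g).
rewrite -csumD.
- apply: eq_csum => k; rewrite [gterm (m + 1 + 1) _ _]gterm_shift /uwt !cfunS.
  by have d0 := subr1_qX_neq0 k; field.
- exact: (tame_uwt _ (tame_subr1_qXV (geo_gtermS _))).
- exact: (tame_cst (-1) (geoS g)).
Qed.

(** * Casoratians of the recurrence and their dependence on [m] *)

Definition Wronskian m : C := G1 m q * G0 (m + 1) q - G1 (m + 1) q * G0 m q.

Lemma WronskianS m : Wronskian (m + 1) = Wronskian m.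
Proof. by rewrite /Wronskian G0_rec G1_rec; ring. Qed.

(** [L0] is the Casoratian of [G2] and [G0]; the homogeneous parts cancel and the source term [1] of
    [G2] contributes [- G0 (m+1)]. *)
Lemma L0S m : L0 (m + 1) q = L0 m q - G0 (m + 1) q.
Proof. by rewrite /L0 G0_rec G2_rec; ring. Qed.

Lemma L1S m : L1 (m + 1) q = L1 m q - G1 (m + 1) q.
Proof. by rewrite /L1 G1_rec G2_rec; ring. Qed.

(** * Behaviour as [m] tends to infinity *)

Lemma geo_csum_gterm w : tame w ->
  geo (fun m : nat => csum (fun n => w n * gterm m%:Z q n) - w 0%N).
Proof.
move=> tw; have ga : geo (fun n => w n * gterm 0 q n) by exact: tw (geo_gterm 0).
apply: eq_geo (geo_csum_tail q1 (geoS ga)) => m.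
rewrite [in RHS]csum_recl; last exact: tw (geo_gterm m).
rewrite gterm0 mulr1 [in RHS]addrC addKr.
by apply: eq_csum => k; rewrite gterm_natE mulrA.
Qed.

Lemma geo_U0 : geo (fun m : nat => U0 m%:Z).
Proof.
have g := geo_csum_tail q1 (tame_subr1_qXV (geo_gtermS 1)).
apply: eq_geo g => m; rewrite U0E; apply: eq_csum => k.
by rewrite [_%:Z + 1]addrC gtermD -PoszM -[LHS]mulrA.
Qed.

(** The weight depends on [m] only through an added [m], so [U1 m] is a series of fixed weight plus
    [m * U0 m], and both decay. *)
Lemma geo_U1 : geo (fun m : nat => U1 m%:Z).
Proof.
have g0 := tame_subr1_qXV (geo_gtermS 1).
have g := geo_csum_tail q1 (tame_uwt 0 g0).
apply: eq_geo (geoD g (tame_nat geo_U0)) => m.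
rewrite U1E U0E -csumZ; last exact: (tame_subr1_qXV (geo_gtermS _)).
rewrite -csumD.
- apply: eq_csum => k; rewrite [_%:Z + 1]addrC gtermD -PoszM /uwt /cfun.
  by rewrite -exprnP /=; ring.
- apply: eq_geo (tame_uwt 0 (tame_subr1_qXV (geo_gtermS (1 + m%:Z)))) => k.
  by rewrite gtermD -PoszM; move: (gterm 1 q _) => z; rewrite !mulrA.
- exact: (tame_cst m%:R (tame_subr1_qXV (geo_gtermS _))).
Qed.

Lemma geoB_mul (u v p r : nat -> C) : tame p -> tame r ->
  geo (fun n => u n - p n) -> geo (fun n => v n - r n) ->
  geo (fun n => u n * v n - p n * r n).
Proof.
move=> tp tr gu gv.
(* [uv - pr = (u-p)(v-r) + p(v-r) + r(u-p)]. *)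
apply: eq_geo (geoD (geo_tame gu gv) (geoD (tp _ gv) (tr _ gu))) => n; ring.
Qed.

(* [lead1] and [lead2] are the [n = 0] summands of [G1] and [G2]; that of [G0] is [1]. *)
Definition cfun00 : C := 2^-1 - 2 * Ekn 1 0 q.
Definition hcst : C := Ekn 2 0 q + 24^-1 * E2 q.
Definition lead1 (m : nat) : C := m%:R + cfun00.
Definition lead2 (m : nat) : C := 2^-1 * (m%:R + cfun00) ^+ 2 - hcst.

Lemma G0_asymp : geo (fun m : nat => G0 m%:Z q - 1).
Proof.
apply: eq_geo (geo_csum_gterm (tame_cst 1)) => m; congr (_ - _).
by apply: eq_csum => n; rewrite mul1r.
Qed.

Lemma csum_cfun_asymp : geo (fun m : nat => csum (fun n => cfun 0 q n * gterm m%:Z q n) - cfun00).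
Proof.
apply: eq_geo (geo_csum_gterm (tame_cfun 0)) => m.
by rewrite /cfun /cfun00; ring.
Qed.

Lemma G1_asymp : geo (fun m : nat => G1 m%:Z q - lead1 m).
Proof.
apply: eq_geo (geoD csum_cfun_asymp (tame_nat G0_asymp)) => m.
have -> : G1 m%:Z q = csum (fun n => cfun 0 q n * gterm m%:Z q n) + m%:R * G0 m%:Z q.
  rewrite -(csumZ _ (geo_gterm _)) -(csumD (tame_cfun _ (geo_gterm _))
    (tame_cst m%:R (geo_gterm _))).
  by apply: eq_csum => n; rewrite /cfun -mulrDl; congr (_ * _); ring.
by rewrite /lead1; ring.
Qed.

(** Since [cfun m = cfun 0 + m], the weight expands as [hfun 0 + m cfun 0 + m^2/2]; each of the
    three series tends geometrically to its [n = 0] term, and powers of [m] are tame. *)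
Lemma G2_asymp : geo (fun m : nat => G2 m%:Z q - lead2 m).
Proof.
have t2 : tame (fun m : nat => 2^-1 * m%:R ^+ 2 : C).
  by do !apply: tameM; [exact: tame_cst|exact: tame_nat..].
apply: eq_geo (geoD (geo_csum_gterm (tame_hfun 0))
  (geoD (tame_nat csum_cfun_asymp) (t2 _ G0_asymp))) => m.
have gc : geo (fun n => cfun 0 q n * gterm m%:Z q n) by exact: (tame_cfun _ (geo_gterm _)).
have gh : geo (fun n => hfun 0 n * gterm m%:Z q n) by exact: (tame_hfun _ (geo_gterm _)).
have -> : G2 m%:Z q = csum (fun n => hfun 0 n * gterm m%:Z q n)
  + (m%:R * csum (fun n => cfun 0 q n * gterm m%:Z q n) + 2^-1 * m%:R ^+ 2 * G0 m%:Z q).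
  have g1 := tame_cst m%:R gc.
  have g2 := tame_cst (2^-1 * m%:R ^+ 2) (geo_gterm m%:Z).
  rewrite -(csumZ _ gc) -(csumZ _ (geo_gterm _)) -(csumD g1 g2) -(csumD gh (geoD g1 g2)).
  apply: eq_csum => n; have -> : cfun m%:Z q n = cfun 0 q n + m%:R.
    by rewrite /cfun; ring.
  by rewrite /hfun; field.
by rewrite /lead2 /hfun /cfun /hcst /cfun00; field.
Qed.

Lemma tame_lead1 : tame lead1.
Proof. by apply: tameD; [exact: tame_nat|exact: tame_cst]. Qed.

Lemma tame_lead2 : tame lead2.
Proof.
apply: tameD; last exact: tame_cst.
by do !apply: tameM; [exact: tame_cst|exact: tame_lead1..].
Qed.

Lemma shift_asymp (F : int -> C) (p : nat -> C) :
  geo (fun m : nat => F m%:Z - p m) -> geo (fun m : nat => F (m%:Z + 1) - p m.+1).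
Proof.
move/geoS; apply: eq_geo => m; congr (F _ - _).
by rewrite intS addrC.
Qed.

Lemma cross_asymp (F H : int -> C) (p r : nat -> C) : tame p -> tame r ->
  tame (fun m : nat => p m.+1) -> tame (fun m : nat => r m.+1) ->
  geo (fun m : nat => F m%:Z - p m) -> geo (fun m : nat => H m%:Z - r m) ->
  geo (fun m : nat => F m%:Z * H (m%:Z + 1) - F (m%:Z + 1) * H m%:Z
                      - (p m * r m.+1 - p m.+1 * r m)).
Proof.
move=> tp tr tp' tr' gF gH.
have g1 := geoB_mul tp tr' gF (shift_asymp gH).
have g2 := geoB_mul tp' tr (shift_asymp gF) gH.
by apply: eq_geo (geoD g1 (geoN g2)) => m; ring.
Qed.

(** * Identification of the constants *)

(** Decay along the naturals is enough: shift invariance carries the value zero to negative [m] as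
    well. *)
Lemma shift_invariant_eq0 (F : int -> C) : (forall m, F (m + 1) = F m) ->
  geo (fun m : nat => F m%:Z) -> forall m, F m = 0.
Proof.
move=> hF gF.
have hn m (n : nat) : F (m + n%:Z) = F m.
  elim: n => [|n IH]; first by rewrite addr0.
  by rewrite intS [1 + _]addrC addrA hF.
have F0 : F 0 = 0.
  by apply: geo_const; apply: eq_geo gF => m; rewrite -(hn 0 m) add0r.
case=> n; first by rewrite -[Posz n]add0r hn.
by rewrite -(hn _ n.+1) NegzE addNr.
Qed.

Lemma lead1S (m : nat) : lead1 m.+1 = lead1 m + 1.
Proof. by rewrite /lead1 -natr1; ring. Qed.

Lemma tame_lead1S : tame (fun m : nat => lead1 m.+1).
Proof.
have := tameD tame_lead1 (tame_cst 1); apply: eq_tame => m; by rewrite lead1S.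
Qed.

Lemma tame_lead2S : tame (fun m : nat => lead2 m.+1).
Proof.
apply: tameD; last exact: tame_cst.
by do !apply: tameM; [exact: tame_cst|exact: tame_lead1S..].
Qed.

(** The leading part is [lead1 m - lead1 (m+1) = -1]. *)
Lemma Wronskian_eqN1 m : Wronskian m = -1.
Proof.
apply/eqP; rewrite -subr_eq0; apply/eqP; move: m.
apply: (@shift_invariant_eq0 (fun m => Wronskian m - -1)) => [m|].
  by rewrite WronskianS.
have := @cross_asymp (fun i => G1 i q) (fun i => G0 i q) lead1 (fun=> 1)
  tame_lead1 (tame_cst 1) tame_lead1S (tame_cst 1) G1_asymp G0_asymp.
by apply: eq_geo => m; rewrite lead1S /Wronskian; ring.
Qed.

(** The leading part is [lead2 m - lead2 (m+1) = - lead1 m - 1/2], which is [2 E_1 - 1 - m]. *)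
Lemma L0E m : L0 m q = 2 * Ekn 1 0 q - 1 - m%:~R + U0 m.
Proof.
apply/eqP; rewrite -subr_eq0; apply/eqP; move: m.
apply: (@shift_invariant_eq0
  (fun m => L0 m q - (2 * Ekn 1 0 q - 1 - m%:~R + U0 m))) => [m|].
  by rewrite L0S U0S intrD; ring.
have := @cross_asymp (fun i => G2 i q) (fun i => G0 i q) lead2 (fun=> 1)
  tame_lead2 (tame_cst 1) tame_lead2S (tame_cst 1) G2_asymp G0_asymp.
move=> g; apply: eq_geo (geoD g (geoN geo_U0)) => m.
by rewrite /lead2 -/(lead1 m) -/(lead1 m.+1) lead1S /lead1 /cfun00 /L0; field.
Qed.

(** With [l = lead1 m], the leading part is [(l^2/2 - hcst)(l+1) - ((l+1)^2/2 - hcst) l = - l(l+1)/2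
    - hcst]; expanding it gives the stated polynomial in [m]. *)
Lemma L1E m : L1 m q = - (3 / 8) - 2 * (Ekn 1 0 q) ^+ 2 + 2 * Ekn 1 0 q - Ekn 2 0 q
  - 24^-1 * E2 q + 2 * m%:~R * Ekn 1 0 q - m%:~R - m%:~R ^+ 2 / 2 + U1 m.
Proof.
apply/eqP; rewrite -subr_eq0; apply/eqP; move: m.
apply: (@shift_invariant_eq0 (fun m => L1 m q - (- (3 / 8) - 2 * (Ekn 1 0 q) ^+ 2
  + 2 * Ekn 1 0 q - Ekn 2 0 q - 24^-1 * E2 q + 2 * m%:~R * Ekn 1 0 q - m%:~R
  - m%:~R ^+ 2 / 2 + U1 m))) => [m|].
  by rewrite L1S U1S /cfun !intrD; field.
have := @cross_asymp (fun i => G2 i q) (fun i => G1 i q) lead2 lead1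
  tame_lead2 tame_lead1 tame_lead2S tame_lead1S G2_asymp G1_asymp.
move=> g; apply: eq_geo (geoD g (geoN geo_U1)) => m.
by rewrite /lead2 -/(lead1 m) -/(lead1 m.+1) lead1S /lead1 /cfun00 /hcst /L1; field.
Qed.

(** * The matrix inverse *)

Lemma Jmat_mul_Jinv m : Jmat m q *m Jinv m q = 1%:M.
Proof.
have := Wronskian_eqN1 m; rewrite /Wronskian => hW.
have hW' : G1 (m + 1) q * G0 m q = 1 + G1 m q * G0 (m + 1) q.
  by rewrite (canRL (subrK _) hW); ring.
apply/matrixP => i j; rewrite !mxE !big_ord_recl big_ord0 !mxE.
case: i => -[|[|[|//]]] hi; case: j => -[|[|[|//]]] hj /=; rewrite /L0 /L1; try by ring.
(* Only the last two diagonal entries need the value of the Wronskian; the others hold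
   identically. *)
- by ring: hW'.
- by ring: hW'.
Qed.
End QSeries.

Theorem theorem2p2 (R : realType) (q : R[i]) (m : int) :
  q != 0 -> `|q| < 1 ->
  [/\ Jmat m q \in unitmx,
      invmx (Jmat m q) = Jinv m q,
      L0 m q = 2 * Ekn 1 0 q - 1 - m%:~R
               + csum (fun k => gterm 0 q k.+1 * q ^ (m * (k.+1)%:Z + (k.+1)%:Z)
                                / (1 - q ^+ k.+1))
    & L1 m q = - (3 / 8) - 2 * (Ekn 1 0 q) ^+ 2 + 2 * Ekn 1 0 q - Ekn 2 0 q
               - 24^-1 * E2 q + 2 * m%:~R * Ekn 1 0 q - m%:~R - m%:~R ^+ 2 / 2
               + csum (fun k => gterm 0 q k.+1 * q ^ (m * (k.+1)%:Z + (k.+1)%:Z)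
                                / (1 - q ^+ k.+1)
                                * ((k.+1)%:R + m%:~R + 2^-1 - 2 * Ekn 1 k.+1 q
                                   + (1 - q ^+ k.+1)^-1))].
Proof.
move=> q0; rewrite normrE_normc ltcR => q1.
have JJ := Jmat_mul_Jinv q0 q1 m; have [uJ _] := mulmx1_unit JJ.
split=> //; first by rewrite -[LHS]mulmx1 -JJ mulKmx.
- exact: L0E.
- exact: L1E.
Qed.
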